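(* Suppose that a codeword of length $N$ is transmitted over the finite-state channel with the random coding scheme and maximum-likelihood decoding described in the context. Then, for all states $s_0, s_N$, the joint probability that decoding fails at the destination and $S_N = s_N$, conditioned on the initial state $S_0 = s_0$, satisfies $$ \begin{aligned} P_{\mathrm{e}, S_N|S_0}(s_N|s_0) &\leq \sum_{T \in \mathcal{T}_N} P_{\mathcal{T}(\mathbf{S}), S_N|S_0}(T, s_N|s_0)\, \min_{\rho\in[0,1]} e^{-N\left(E_{0,N}(\rho,\mathbf{Q}_N,T)-\rho R\right)} \\ &\leq \min_{\rho\in[0,1]} \sum_{T \in \mathcal{T}_N} P_{\mathcal{T}(\mathbf{S}), S_N|S_0}(T, s_N|s_0)\, e^{-N\left(E_{0,N}(\rho,\mathbf{Q}_N,T)-\rho R\right)} , \end{aligned} $$ where $P_{\mathcal{T}(\mathbf{S}), S_N|S_0}(T,s_N|s_0)$ is the probability that $\mathcal{T}(\mathbf{S})=T$ and $S_N=s_N$, given $S_0=s_0$.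
   Context: Channel: finite input alphabet, output alphabet and state set. At time $n\ge 1$ the input is $X_n$, the output is $Y_n$, and the state governing the channel law is $S_{n-1}$. State transitions are independent of the inputs, i.e. $$P_{Y_n,S_n|X_n,S_{n-1}}(y_n,s_n|x_n,s_{n-1}) = P_{S_n|S_{n-1}}(s_n|s_{n-1})\,P_{Y_n|X_n,S_{n-1}}(y_n|x_n,s_{n-1}),$$ with statistics homogeneous in time, so $\{S_n\}$ is a time-homogeneous Markov chain; given inputs $x_1,\dots,x_N$ and $S_0=s_0$, the joint law of $(Y_1,S_1,\dots,Y_N,S_N)$ is the product over $n=1,\dots,N$ of these conditional laws. Write $\mathbf{S}=(S_0,\dots,S_{N-1})$ for the states governing the $N$ channel uses of the codeword. Random coding: $Q$ is a probability distribution on the input alphabet and $\mathbf{Q}_N(\mathbf{x})=\prod_{n=1}^N Q(x_n)$. The code has $M=e^{NR}$ codewords ($R$ is the rate in nats per code symbol, $M$ a positive integer), drawn independently, each according to $\mathbf{Q}_N$, and independently of the channel. The transmitted message index is independent of the codebook and the channel. The receiver knows the codebook and the channel state sequence and uses maximum-likelihood decoding, i.e. outputs an index $k$ maximizing $\prod_{n=1}^N P_{Y_n|X_n,S_{n-1}}(y_n|x_n(k),s_{n-1})$. Decoding failure is the event that the decoded index differs from the transmitted one; its probability is taken over the random codebook as well as over the channel. $P_{\mathrm{e},S_N|S_0}(s_N|s_0)$ is the probability that decoding fails and $S_N=s_N$, given $S_0=s_0$. Types: for $\mathbf{s}=(s_0,\dots,s_{N-1})$, $\mathcal{T}(\mathbf{s})$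 is its empirical distribution (the fraction of the $N$ entries equal to each state), and $\mathcal{T}_N$ is the set of all empirical distributions of length-$N$ state sequences. Exponent: for $\rho\in[0,1]$, $$E_{0,N}(\rho,\mathbf{Q}_N,\mathbf{s}) = -\frac1N \ln \prod_{n=1}^N \sum_{y_n}\Big[\sum_{x_n} Q(x_n)\, P_{Y_n|X_n,S_{n-1}}(y_n|x_n,s_{n-1})^{\frac{1}{1+\rho}}\Big]^{1+\rho}.$$ This depends on $\mathbf{s}$ only through $\mathcal{T}(\mathbf{s})$; $E_{0,N}(\rho,\mathbf{Q}_N,T)$ denotes its common value for all $\mathbf{s}$ with $\mathcal{T}(\mathbf{s})=T$. *)

(* Defs.v *)
From HB Require Import structures.
From mathcomp Require Import all_boot all_order all_algebra.
From mathcomp Require Import all_classical all_reals all_analysis.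

Set Implicit Arguments.
Unset Strict Implicit.
Unset Printing Implicit Defensive.

Import Order.TTheory GRing.Theory Num.Theory.

Local Open Scope ring_scope.

Definition is_pmf (R : realType) (A : finType) (f : A -> R) : Prop :=
  (forall a, 0 <= f a) /\ \sum_a f a = 1.

Definition Pr (R : realType) (A : finType) (f : A -> R) (E : pred A) : R :=
  \sum_(a | E a) f a.

(* The minimum over [0, 1].  [inf] is a total operator, so [min01 f] is the
   minimum of [f] exactly when [is_min01 f (min01 f)] holds. *)
Definition min01 (R : realType) (f : R -> R) : R :=
  inf [set f rho | rho in [set rho : R | 0 <= rho <= 1]]%classic.

Definition is_min01 (R : realType) (f : R -> R) (m : R) : Prop :=
  (exists2 rho : R, 0 <= rho <= 1 & f rho = m) /\
  (forall rho : R, 0 <= rho <= 1 -> m <= f rho).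

(* A finite-state channel with input-independent state transitions:
   [trans s s'] is P(S_n = s' | S_(n-1) = s) and
   [out x s y] is P(Y_n = y | X_n = x, S_(n-1) = s). *)
Record channel (R : realType) (X Y S : finType) := Channel {
  trans : S -> S -> R;
  out : X -> S -> Y -> R;
  trans_pmf : forall s, is_pmf (trans s);
  out_pmf : forall x s, is_pmf (out x s)
}.

Section Coding.
Context (R : realType) (X Y S : finType).
Implicit Types (W : channel R X Y S) (Q : X -> R).

(* P(Y_n = y, S_n = s' | X_n = x, S_(n-1) = s) *)
Definition step_law W (x : X) (s : S) (y : Y) (s' : S) : R :=
  trans W s s' * out W x s y.

(* A channel use n = 1, ..., N is represented by the index n - 1 : 'I_N, and a
   state trajectory S_0, ..., S_N by a function on 'I_N.+1. *)
Definition input (N : nat) := {ffun 'I_N -> X}.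
Definition output (N : nat) := {ffun 'I_N -> Y}.
Definition states (N : nat) := {ffun 'I_N -> S}.
Definition trajectory (N : nat) := {ffun 'I_N.+1 -> S}.
Definition codebook (N M : nat) := {ffun 'I_M -> {ffun 'I_N -> X}}.

Definition initial_state N (p : trajectory N) : S := p ord0.
Definition final_state N (p : trajectory N) : S := p ord_max.

(* (S_0, ..., S_(N-1)) *)
Definition governing N (p : trajectory N) : states N :=
  [ffun n => p (widen_ord (leqnSn N) n)].

(* (S_1, ..., S_N) *)
Definition successors N (p : trajectory N) : states N :=
  [ffun n => p (lift ord0 n)].

(* Law of the outputs and of the trajectory given the inputs and S_0 = s0. *)
Definition block_law W N (s0 : S) (x : input N) (p : trajectory N)
    (y : output N) : R :=
  (initial_state p == s0)%:R *
  \prod_(n < N) step_law W (x n) (governing p n) (y n) (successors p n).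

Definition codeword_law Q N (x : input N) : R := \prod_(n < N) Q (x n).

Definition codebook_law Q N M (c : codebook N M) : R :=
  \prod_(k < M) codeword_law Q (c k).

Definition outcome (N M : nat) : finType :=
  ('I_M * {ffun 'I_M -> {ffun 'I_N -> X}} *
   {ffun 'I_N.+1 -> S} * {ffun 'I_N -> Y})%type.

Definition message N M (w : outcome N M) : 'I_M := w.1.1.1.
Definition code N M (w : outcome N M) : codebook N M := w.1.1.2.
Definition state_path N M (w : outcome N M) : trajectory N := w.1.2.
Definition received N M (w : outcome N M) : output N := w.2.

(* Conditional law, given S_0 = s0, of the whole experiment: the message has law
   [mu]; message, codebook and state process are independent. *)
Definition coding_law W Q N M (mu : 'I_M -> R) (s0 : S) (w : outcome N M) : R :=
  mu (message w) * codebook_law Q (code w) *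
  block_law W s0 (code w (message w)) (state_path w) (received w).

Definition likelihood W N (x : input N) (s : states N) (y : output N) : R :=
  \prod_(n < N) out W (x n) (s n) (y n).

(* The decoder sees the codebook, the state sequence (S_N included) and the
   outputs; ties between likelihood maximizers are broken arbitrarily. *)
Definition decoder (N M : nat) :=
  codebook N M -> trajectory N -> output N -> 'I_M.

Definition maximum_likelihood W N M (dec : decoder N M) : Prop :=
  forall (c : codebook N M) (p : trajectory N) (y : output N) (k : 'I_M),
    likelihood W (c k) (governing p) y <=
    likelihood W (c (dec c p y)) (governing p) y.

Definition decoding_fails N M (dec : decoder N M) (w : outcome N M) : bool :=
  dec (code w) (state_path w) (received w) != message w.

(* The "type" of a sequence, in the sense of the method of types. *)
Definition type_of N (s : states N) : {ffun S -> R} :=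
  [ffun a => #|[set n | s n == a]|%:R / N%:R].

Definition types (N : nat) : seq {ffun S -> R} :=
  undup [seq type_of s | s : {ffun 'I_N -> S}].

Definition error_prob W Q N M (mu : 'I_M -> R) (dec : decoder N M)
    (s0 sN : S) : R :=
  Pr (coding_law W Q mu s0)
     (fun w : outcome N M =>
        decoding_fails dec w && (final_state (state_path w) == sN)).

Definition type_prob W Q N M (mu : 'I_M -> R) (s0 : S)
    (T : {ffun S -> R}) (sN : S) : R :=
  Pr (coding_law W Q mu s0)
     (fun w : outcome N M => let p := state_path w in
        (type_of (governing p) == T) && (final_state p == sN)).

Definition E0_seq W Q N (rho : R) (s : states N) : R :=
  - (N%:R^-1) * ln (\prod_(n < N) \sum_(y : Y)
      (\sum_(x : X) Q x * (out W x (s n) y) `^ (1 / (1 + rho))) `^ (1 + rho)).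

(* The value of [E0_seq] at any sequence of type [T] (see [E0_type_of]); it is
   irrelevant, here 0, when [T] is not in [types N]. *)
Definition E0 W Q (N : nat) (rho : R) (T : {ffun S -> R}) : R :=
  if [pick s : {ffun 'I_N -> S} | type_of s == T] is Some s
  then E0_seq W Q rho s else 0.

Lemma E0_seq_type W Q N (rho : R) (s t : states N) :
  type_of s = type_of t -> E0_seq W Q rho s = E0_seq W Q rho t.
Proof.
case: N s t => [|N] s t est; first by have -> : s = t by apply/ffunP => -[].
have prodE (F : S -> R) (u : states N.+1) :
    \prod_(n < N.+1) F (u n) = \prod_a F a ^+ #|[set n | u n == a]|.
  rewrite (partition_big u xpredT) //=; apply: eq_bigr => a _.
  rewrite -prodr_const; apply: eq_big => [n|n /eqP->//].
  by rewrite inE.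
have [F E0E] : exists F : S -> R, forall u : states N.+1,
    E0_seq W Q rho u = - (N.+1%:R^-1) * ln (\prod_(n < N.+1) F (u n)).
  by exists (fun a => \sum_(y : Y)
    (\sum_(x : X) Q x * (out W x a y) `^ (1 / (1 + rho))) `^ (1 + rho)).
rewrite !E0E !prodE.
suff -> : \prod_a F a ^+ #|[set n | s n == a]| =
          \prod_a F a ^+ #|[set n | t n == a]| by [].
apply: eq_bigr => a _; move: (F a) => z.
suff -> : #|[set n | s n == a]| = #|[set n | t n == a]| by [].
have /eqP := congr1 (fun f : {ffun S -> R} => f a) est.
rewrite !ffunE (inj_eq (mulIf _)) ?invr_eq0 ?pnatr_eq0 //.
by rewrite eqr_nat => /eqP.
Qed.

Lemma E0_type_of W Q N (rho : R) (s : states N) :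
  E0 W Q N rho (type_of s) = E0_seq W Q rho s.
Proof.
rewrite /E0; case: pickP => [t /eqP /E0_seq_type -> //|/(_ s)].
by rewrite eqxx.
Qed.

End Coding.

(* Main.v *)
(* Given the state path the channel is memoryless, so Gallager's random coding
   bound applies path by path: the probability that a wrong codeword wins is at
   most M^rho times the product of the one-letter terms [gallager rho (s n)],
   for every rho in [0, 1].  This bound depends on the path only through its
   type, so rho may be optimized for each type before averaging over paths.  The
   minima exist because each one-letter term is continuous in rho on [0, 1]. *)
Require Import Defs.
From mathcomp Require Import all_boot all_order all_algebra.
From mathcomp Require Import all_classical all_reals all_analysis.
From mathcomp Require Import ring lra.

Set Implicit Arguments.
Unset Strict Implicit.
Unset Printing Implicit Defensive.

Import Order.TTheory GRing.Theory Num.Theory.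
Import numFieldNormedType.Exports.

Local Open Scope ring_scope.

(** * Inequalities for real powers *)

Lemma powR_prod (R : realType) (I : finType) (F : I -> R) (r : R) :
  (forall i, 0 <= F i) -> (\prod_i F i) `^ r = \prod_i F i `^ r.
Proof.
move=> F0; suff [_ ->] : 0 <= \prod_i F i /\
  (\prod_i F i) `^ r = \prod_i F i `^ r by [].
elim/big_ind2 : _ => [|x y u v [x0 <-] [y0 <-]|i _]; first by rewrite powR1.
- by split; [rewrite mulr_ge0|rewrite powRM].
- by [].
Qed.

(** With [c = rho * ln t], the tangent to the exponential at [c] lies below it at the points [0] and
    [ln t]. Weighting these two bounds by [1 - rho] and [rho] cancels the slope, since [c] is the
    weighted mean of the two points. *)
Lemma powR_le_affine (R : realType) (t rho : R) :
  0 <= t -> 0 <= rho <= 1 -> t `^ rho <= 1 - rho + rho * t.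
Proof.
rewrite le_eqVlt => /predU1P[<-|t0] /andP[rho0 rho1].
  by rewrite /powR eqxx mulr0 addr0; case: eqP => [->|_] /=; lra.
have -> : t `^ rho = expR (rho * ln t) by rewrite /powR gt_eqF.
set c := rho * ln t.
have h1 : expR c * (1 - c) <= 1.
  rewrite -[leRHS](expRxMexpNx_1 c) ler_pM2l ?expR_gt0//.
  exact: expR_ge1Dx.
have h2 : expR c * (1 + (ln t - c)) <= t.
  rewrite -[leRHS]lnK// -[in leRHS](subrKC c (ln t)) expRD.
  by rewrite ler_pM2l ?expR_gt0// expR_ge1Dx.
have {}h1 := ler_wpM2l (_ : 0 <= 1 - rho) h1.
have {}h2 := ler_wpM2l rho0 h2.
have {}h1 := h1 ltac:(lra).
have -> : expR c = (1 - rho) * (expR c * (1 - c)) +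
    rho * (expR c * (1 + (ln t - c))) by rewrite /c; ring.
by apply: le_trans (lerD h1 h2) _; rewrite mulr1.
Qed.

(** Concavity of the power [rho] under unnormalized weights. The affine bound is applied to [Z i]
    divided by the weighted mean [B / A]; the affine terms then average to 1. *)
Lemma hoelder_powR (R : realType) (I : finType) (p Z : I -> R) (rho : R) :
  (forall i, 0 <= p i) -> (forall i, 0 <= Z i) -> 0 <= rho <= 1 ->
  \sum_i p i * Z i `^ rho
    <= (\sum_i p i) `^ (1 - rho) * (\sum_i p i * Z i) `^ rho.
Proof.
move=> p0 Z0 /andP[rho0 rho1].
have pZ0 i : 0 <= p i * Z i by rewrite mulr_ge0.
have sp0 : 0 <= \sum_i p i by rewrite sumr_ge0.
have spZ0 : 0 <= \sum_i p i * Z i by rewrite sumr_ge0.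
(* The case [rho = 0] is separate because of the convention that 0 to the power 0 is 1, which would
   break the case where the weighted sum vanishes. *)
have [->|rhoN0] := eqVneq rho 0.
  rewrite subr0 powRr0 mulr1 powRr1//; apply: ler_sum => i _.
  by rewrite powRr0 mulr1.
have [B0|BN0] := eqVneq (\sum_i p i * Z i) 0.
  rewrite big1 ?mulr_ge0 ?powR_ge0// => i _.
  have/eqP : p i * Z i = 0 by exact: (psumr_eq0P (fun i _ => pZ0 i) B0).
  by rewrite mulf_eq0 => /orP[]/eqP->; rewrite ?mul0r// powR0// mulr0.
have AN0 : \sum_i p i != 0.
  apply: contraNneq BN0 => A0; rewrite big1// => i _.
  by rewrite (psumr_eq0P (fun i _ => p0 i) A0)// mul0r.
set A := \sum_i p i in sp0 AN0 *; set B := \sum_i _ in spZ0 BN0 *.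
have A0 : 0 < A by rewrite lt_def AN0.
have B0 : 0 < B by rewrite lt_def BN0.
have m0 : 0 < B / A by rewrite divr_gt0.
have -> : A `^ (1 - rho) * B `^ rho = A * (B / A) `^ rho.
  rewrite powRM ?invr_ge0// powRB ?AN0 ?implybT// powRr1//.
  by rewrite -(powR_inv1 sp0) -powRrM mulN1r powRN; ring.
have -> : A * (B / A) `^ rho =
    \sum_i p i * ((B / A) `^ rho * (1 - rho + rho * (Z i / (B / A)))).
  under eq_bigr => i _.
    have -> : p i * ((B / A) `^ rho * (1 - rho + rho * (Z i / (B / A)))) =
      ((B / A) `^ rho * (1 - rho)) * p i
       + ((B / A) `^ rho * rho / (B / A)) * (p i * Z i) by ring.
    over.
  by rewrite big_split -!mulr_sumr -/A -/B /=; field; rewrite AN0.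
apply: ler_sum => i _; apply: ler_wpM2l => //.
rewrite -{1}[Z i](divfK (lt0r_neq0 m0)) mulrC.
rewrite [leLHS]powRM; [|exact: ltW|by rewrite mulr_ge0// invr_ge0 ltW].
apply: ler_wpM2l; first exact: powR_ge0.
by apply: powR_le_affine; rewrite ?rho0// mulr_ge0// invr_ge0 ltW.
Qed.

(** If [j != k], then [j] is one of the competitors in the sum and [L j] is at least [L k], so the
    right side is at least [L k] to the power [a + a * rho = 1], where [a = 1 / (1 + rho)]. *)
Lemma maximizer_indicator_le (R : realType) (I : finType) (L : I -> R) (j k : I)
    (rho : R) : (forall i, 0 <= L i) -> L k <= L j -> 0 <= rho ->
  L k * (j != k)%:R <= L k `^ (1 / (1 + rho)) *
    (\sum_(i | i != k) L i `^ (1 / (1 + rho))) `^ rho.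
Proof.
move=> L0 Lkj rho0; set a := 1 / (1 + rho).
have a0 : 0 <= a by rewrite /a divr_ge0//; lra.
have [_|jk] := eqVneq j k; first by rewrite mulr0 mulr_ge0 ?powR_ge0.
have aD : a + a * rho = 1 by rewrite /a; field; lra.
rewrite mulr1 -{1}(powRr1 (L0 k)) -{1}aD powRD ?aD ?oner_eq0//.
rewrite ler_wpM2l ?powR_ge0// powRrM ge0_ler_powR ?nnegrE ?powR_ge0//.
  by rewrite sumr_ge0// => *; exact: powR_ge0.
rewrite (bigD1 j)//= ler_wpDr ?sumr_ge0//.
  by move=> *; exact: powR_ge0.
by rewrite ge0_ler_powR ?nnegrE.
Qed.

(** * Continuity of powers and existence of minima on [0, 1] *)

(** Base and exponent vary together. The positive limit keeps the base positive nearby, where the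
    power is [expR (e x * ln (f x))]. *)
Lemma cvg_powR (R : realType) (T : Type) (F : set_system T) (FF : Filter F)
    (f e : T -> R) (a b : R) :
  (f x @[x --> F] --> a)%classic -> (e x @[x --> F] --> b)%classic -> 0 < a ->
  (f x `^ e x @[x --> F] --> a `^ b)%classic.
Proof.
move=> fa eb a0.
apply: (@cvg_trans _ (expR (e x * ln (f x)) @[x --> F])%classic).
  apply: near_eq_cvg; near=> x; rewrite /powR gt_eqF//.
  by near: x; exact: cvgr_gt fa _ a0.
rewrite /powR gt_eqF//; apply: continuous_cvg; first exact: continuous_expR.
by apply: cvgM => //; apply: continuous_cvg => //; exact: continuous_ln.
Unshelve. all: by end_near. Qed.

Lemma is_min01_continuous (R : realType) (f : R -> R) :
  {in `[0, 1], continuous f} -> is_min01 f (min01 f).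
Proof.
move=> cf; have [|c] := @EVT_min R f 0 1 ler01.
  by apply: continuous_in_subspaceT => x; rewrite inE; exact: cf.
rewrite in_itv /= => c01 fc.
have lbf : lbound [set f rho | rho in [set rho : R | 0 <= rho <= 1]]%classic (f c).
  by move=> _ [t /= t01 <-]; apply: fc; rewrite in_itv.
suff -> : min01 f = f c.
  by split; [exists c|move=> t t01; apply: fc; rewrite in_itv].
apply/le_anti/andP; split.
  by apply: ge_inf; [exists (f c)|exists c].
by apply: lb_le_inf => //; exists (f c); exists c.
Qed.

(** * Positivity and continuity of the one-letter terms *)

Section Gallager.
Context (R : realType) (X Y S : finType) (W : channel R X Y S) (Q : X -> R).
Hypothesis hQ : is_pmf Q.

Let Q0 x : 0 <= Q x. Proof. exact: hQ.1. Qed.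
Let out0 x s y : 0 <= out W x s y. Proof. exact: (out_pmf W x s).1. Qed.

Definition gallager (rho : R) (s : S) : R :=
  \sum_(y : Y)
    (\sum_(x : X) Q x * out W x s y `^ (1 / (1 + rho))) `^ (1 + rho).

(** Some input and some output given that input have positive probability. Strict positivity is what
    later lets [expR] undo the [ln] in [E0_seq]. *)
Lemma gallager_gt0 rho s : 0 < gallager rho s.
Proof.
have [x Qx] : exists x, 0 < Q x.
  apply/not_existsP => Qn; have := hQ.2.
  rewrite big1 => [/esym/eqP|x _]; first by rewrite oner_eq0.
  by apply/le_anti; rewrite Q0 leNgt; apply/andP; split => //; apply/negP/Qn.
have [y Wy] : exists y, 0 < out W x s y.
  apply/not_existsP => Wn; have := (out_pmf W x s).2.
  rewrite big1 => [/esym/eqP|y _]; first by rewrite oner_eq0.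
  by apply/le_anti; rewrite out0 leNgt; apply/andP; split => //; apply/negP/Wn.
rewrite /gallager (bigD1 y)//= ltr_pwDl ?sumr_ge0// => [|*]; last exact: powR_ge0.
rewrite powR_gt0// (bigD1 x)//= ltr_pwDl ?sumr_ge0// => [|*].
  by rewrite mulr_gt0// powR_gt0.
by rewrite mulr_ge0// powR_ge0.
Qed.

Lemma gallager_continuous s : {in `[0, 1], continuous (gallager ^~ s)}.
Proof.
move=> r; rewrite in_itv /= => /andP[r0 r1].
have cD : (1 + x @[x --> r] --> 1 + r)%classic.
  by apply: cvgD; [exact: cvg_cst|exact: cvg_id].
have ce : (1 / (1 + x) @[x --> r] --> 1 / (1 + r))%classic.
  by apply: cvgM; [exact: cvg_cst|apply: cvgV => //; lra].
have near0 : (\forall t \near r, 0 < 1 + t)%classic.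
  by apply: cvgr_gt cD _ _; lra.
have cW x y : (out W x s y `^ (1 / (1 + t)) @[t --> r]
               --> out W x s y `^ (1 / (1 + r)))%classic.
  (* At a zero base [cvg_powR] fails, but the exponent is nonzero near [r], so the power is locally
     constant, equal to 0. *)
  have [W0|WN0] := eqVneq (out W x s y) 0; last first.
    by apply: cvg_powR ce _; [exact: cvg_cst|rewrite lt_def WN0 out0].
  rewrite W0 powR0; last by rewrite mul1r invr_eq0; lra.
  apply: cvg_near_cst; near=> t; rewrite powR0// mul1r invr_eq0 gt_eqF//.
  by near: t.
have csum y : (\sum_x Q x * out W x s y `^ (1 / (1 + t)) @[t --> r]
               --> \sum_x Q x * out W x s y `^ (1 / (1 + r)))%classic.
  apply: cvg_big => [|x _]; first exact: add_continuous.
  by apply: cvgM; [exact: cvg_cst|exact: cW].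
apply: cvg_big => [|y _]; first exact: add_continuous.
have Qout0 t x : 0 <= Q x * out W x s y `^ t by rewrite mulr_ge0 ?powR_ge0.
(* Either the inner sum vanishes identically near [r], or one summand is positive and [cvg_powR]
   applies to the outer power. *)
have [all0|] := pselect (forall x, Q x * out W x s y = 0).
  have sum0 t : 0 < 1 + t -> \sum_x Q x * out W x s y `^ (1 / (1 + t)) = 0.
    move=> t0; apply: big1 => x _; have /eqP := all0 x.
    rewrite mulf_eq0 => /orP[]/eqP->; rewrite ?mul0r// powR0 ?mulr0//.
    by rewrite mul1r invr_eq0 gt_eqF.
  rewrite sum0 ?powR0; [|lra|lra].
  apply: cvg_near_cst; near=> t.
  have t0 : 0 < 1 + t by near: t.
  by rewrite sum0// powR0// gt_eqF.
move=> /existsNP[x /eqP]; rewrite mulf_eq0 negb_or => /andP[Qx Wx].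
apply: cvg_powR => //; rewrite (bigD1 x)//= ltr_pwDl ?sumr_ge0//.
by rewrite mulr_gt0 ?powR_gt0// lt_def ?Qx ?Wx ?Q0 ?out0.
Unshelve. all: by end_near. Qed.

(** * Averages over the random codebook *)

Let codeword_ge0 N (x : input X N) : 0 <= codeword_law Q x.
Proof. exact: prodr_ge0. Qed.

Let codebook_ge0 N M (c : codebook X N M) : 0 <= codebook_law Q c.
Proof. exact: prodr_ge0. Qed.

Let likelihood_ge0 N (x : input X N) (s : states S N) y :
  0 <= likelihood W x s y.
Proof. exact: prodr_ge0. Qed.

Lemma sum_codeword_likelihood N (s : states S N) y a :
  \sum_(x : input X N) codeword_law Q x * likelihood W x s y `^ a =
  \prod_(n < N) \sum_x Q x * out W x (s n) (y n) `^ a.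
Proof.
rewrite bigA_distr_bigA; apply: eq_bigr => x _.
by rewrite /likelihood powR_prod// -big_split.
Qed.

Lemma sum_codeword_law N : \sum_(x : input X N) codeword_law Q x = 1.
Proof.
by rewrite -(bigA_distr_bigA (fun _ => Q)) big1// => n _; exact: hQ.2.
Qed.

Lemma sum_likelihood N (x : input X N) (s : states S N) :
  \sum_y likelihood W x s y = 1.
Proof.
rewrite -(bigA_distr_bigA (fun n => out W (x n) (s n))) big1// => n _.
exact: (out_pmf W _ _).2.
Qed.

Lemma codebook_expect N M (F : 'I_M -> input X N -> R) :
  \sum_(c : codebook X N M) codebook_law Q c * \prod_i F i (c i) =
  \prod_i \sum_x codeword_law Q x * F i x.
Proof.
by rewrite bigA_distr_bigA; apply: eq_bigr => c _; rewrite -big_split.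
Qed.

Lemma sum_codebook_law N M : \sum_(c : codebook X N M) codebook_law Q c = 1.
Proof.
by rewrite -(bigA_distr_bigA (fun _ => @codeword_law _ _ Q N)) big1// => i _;
  exact: sum_codeword_law.
Qed.

Lemma codebook_expect1 N M (k : 'I_M) (f : input X N -> R) :
  \sum_(c : codebook X N M) codebook_law Q c * f (c k) =
  \sum_x codeword_law Q x * f x.
Proof.
pose F (i : 'I_M) := if i == k then f else fun=> 1.
transitivity (\sum_(c : codebook X N M) codebook_law Q c * \prod_i F i (c i)).
  apply: eq_bigr => c _; rewrite (bigD1 k)//= /F eqxx big1 ?mulr1// => i.
  by move=> /negbTE->.
rewrite codebook_expect (bigD1 k)//= /F eqxx [X in _ * X]big1 ?mulr1// => i /negbTE->.
by under eq_bigr do rewrite mulr1; exact: sum_codeword_law.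
Qed.

Lemma codebook_expect2 N M (k j : 'I_M) (f g : input X N -> R) : j != k ->
  \sum_(c : codebook X N M) codebook_law Q c * (f (c k) * g (c j)) =
  (\sum_x codeword_law Q x * f x) * (\sum_x codeword_law Q x * g x).
Proof.
move=> jk.
(* Codewords other than [k] and [j] carry the factor 1 and integrate out; the two remaining ones are
   independent. *)
pose F (i : 'I_M) := if i == k then f else if i == j then g else fun=> 1.
transitivity (\sum_(c : codebook X N M) codebook_law Q c * \prod_i F i (c i)).
  apply: eq_bigr => c _; rewrite (bigD1 k)//= (bigD1 j)//= /F eqxx.
  rewrite (negbTE jk) eqxx big1 ?mulr1// => i.
  by move=> /andP[/negbTE-> /negbTE->].
rewrite codebook_expect (bigD1 k)//= (bigD1 j)//= /F eqxx (negbTE jk) eqxx.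
rewrite [X in _ * (_ * X)]big1 ?mulr1// => i /andP[/negbTE-> /negbTE->].
by under eq_bigr do rewrite mulr1; exact: sum_codeword_law.
Qed.

(* Taking [codebook_law Q c * L k `^ (1 / (1 + rho))] as the weights of the
   Hölder inequality avoids conditioning on the transmitted codeword. *)
Lemma ml_error_bound N M (dec : decoder X Y S N M) (p : trajectory S N) k
    (rho : R) : maximum_likelihood W dec -> 0 <= rho <= 1 ->
  \sum_(c : codebook X N M) codebook_law Q c *
    \sum_y likelihood W (c k) (governing p) y * (dec c p y != k)%:R
  <= M%:R `^ rho * \prod_(n < N) gallager rho (governing p n).
Proof.
move=> hdec rho01; have /andP[rho0 rho1] := rho01.
set a := 1 / (1 + rho).
pose L (x : input X N) y := likelihood W x (governing p) y `^ a.
pose A y := \sum_(x : input X N) codeword_law Q x * L x y.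
have L0 x y : 0 <= L x y by exact: powR_ge0.
have A0 y : 0 <= A y by apply: sumr_ge0 => x _; rewrite mulr_ge0.
(* Writing the bound as a sum over output blocks reduces the claim to one inequality per output
   [y]. *)
have -> : M%:R `^ rho * \prod_(n < N) gallager rho (governing p n) =
    \sum_y M%:R `^ rho * A y `^ (1 + rho).
  rewrite -mulr_sumr /gallager bigA_distr_bigA; congr *%R.
  apply: eq_bigr => y _; rewrite /A /L sum_codeword_likelihood powR_prod//.
  by move=> n; apply: sumr_ge0 => x _; rewrite mulr_ge0 ?powR_ge0.
under eq_bigr do rewrite mulr_sumr.
rewrite exchange_big /=; apply: ler_sum => y _.
pose Z (c : codebook X N M) := \sum_(j | j != k) L (c j) y.
have Z0 c : 0 <= Z c by exact: sumr_ge0.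
apply: (@le_trans _ _ (\sum_c (codebook_law Q c * L (c k) y) * Z c `^ rho)).
  apply: ler_sum => c _; rewrite -mulrA ler_wpM2l//.
  pose Lc i := likelihood W (c i) (governing p) y.
  have Lc0 i : 0 <= Lc i by exact: likelihood_ge0.
  exact: maximizer_indicator_le Lc0 (hdec c p y k) rho0.
apply: le_trans (hoelder_powR _ Z0 rho01) _ => [c|]; first exact: mulr_ge0.
rewrite (codebook_expect1 k (L ^~ y)) -/(A y).
(* Each competitor is independent of the transmitted codeword, so it contributes [A y * A y]. *)
have -> : \sum_c codebook_law Q c * L (c k) y * Z c =
    \sum_(j | j != k) A y * A y.
  under eq_bigr => c _ do rewrite -mulrA mulr_sumr mulr_sumr.
  rewrite exchange_big; apply: eq_bigr => j jk.
  exact: (codebook_expect2 (L ^~ y) (L ^~ y) jk).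
(* The number of competitors is bounded by [M], and the powers of [A y] have exponents [1 - rho],
   [rho] and [rho], which add up to [1 + rho]. *)
rewrite sumr_const -[_ *+ _]mulr_natl !powRM ?mulr_ge0// mulrCA.
apply: ler_pM; rewrite ?mulr_ge0 ?powR_ge0//.
  rewrite ge0_ler_powR ?nnegrE// ler_nat (leq_trans (max_card _))//.
  by rewrite card_ord.
rewrite mulrA -!powRD ?subrK ?oner_eq0//.
by apply/implyP => /eqP; lra.
Qed.

(** * Separation of the state path from the coding experiment *)

Definition path_law N (s : S) (p : trajectory S N) : R :=
  (initial_state p == s)%:R *
  \prod_(n < N) trans W (governing p n) (successors p n).

Lemma path_law_ge0 N s (p : trajectory S N) : 0 <= path_law s p.
Proof.
rewrite mulr_ge0// prodr_ge0// => n _; exact: (trans_pmf W _).1.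
Qed.

(** Since transitions ignore the inputs, the path weight factors out and the path can be summed
    outermost; the inner sums are probabilities for a fixed path. *)
Lemma Pr_coding_law N M (mu : 'I_M -> R) (s : S) (E : pred (outcome X Y S N M)) :
  Pr (coding_law W Q mu s) E =
  \sum_(p : trajectory S N) path_law s p * \sum_m mu m *
    \sum_(c : codebook X N M) codebook_law Q c *
      \sum_y likelihood W (c m) (governing p) y * (E (m, c, p, y))%:R.
Proof.
rewrite /Pr big_mkcond.
transitivity (\sum_m \sum_(c : codebook X N M) \sum_(p : trajectory S N)
    \sum_(y : output Y N) path_law s p * (mu m * (codebook_law Q c *
      (likelihood W (c m) (governing p) y * (E (m, c, p, y))%:R)))).
  rewrite !pair_bigA; apply: eq_bigr => -[[[m c] p] y] _ /=.
  rewrite /coding_law /block_law /step_law big_split /=.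
  rewrite /path_law /likelihood /message /Defs.code /state_path /received /=.
  by case: (E _); [rewrite mulr1; ring|rewrite !mulr0].
under eq_bigr do rewrite exchange_big /=.
rewrite exchange_big; apply: eq_bigr => p _ /=.
rewrite mulr_sumr; apply: eq_bigr => m _.
rewrite !mulr_sumr; apply: eq_bigr => c _.
by rewrite !mulr_sumr.
Qed.

(** The event concerns the path alone, so outputs, codebook and message each sum to 1. *)
Lemma type_prob_path N M (mu : 'I_M -> R) (s s' : S) T : is_pmf mu ->
  type_prob W Q N mu s T s' = \sum_(p : trajectory S N) path_law s p *
    ((type_of R (governing p) == T) && (final_state p == s'))%:R.
Proof.
move=> hmu; rewrite /type_prob Pr_coding_law; apply: eq_bigr => p _.
rewrite /state_path /=; set b := _%:R; congr *%R.
under eq_bigr => m _.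
  under eq_bigr do rewrite -mulr_suml sum_likelihood mul1r.
  rewrite -mulr_suml sum_codebook_law mul1r; over.
by rewrite -mulr_suml hmu.2 mul1r.
Qed.

(** Links the exponential form of the bound to the product form of [ml_error_bound]: [M] to the
    power [rho] is [expR (N%:R * rho * rate)], and [N > 0] cancels the normalization of [E0_seq]. *)
Lemma expR_E0_seq N M (rate rho : R) (s : states S N) : (0 < N)%N ->
  M%:R = expR (N%:R * rate) ->
  expR (- N%:R * (E0_seq W Q rho s - rho * rate)) =
  M%:R `^ rho * \prod_(n < N) gallager rho (s n).
Proof.
move=> N0 hM; rewrite hM /powR gt_eqF ?expR_gt0// expRK.
rewrite -[\prod_(n < N) gallager _ _]lnK; last first.
  by rewrite posrE prodr_gt0// => n _; exact: gallager_gt0.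
rewrite -expRD; congr expR; rewrite /E0_seq -/(gallager _ _).
have : N%:R != 0 :> R by rewrite pnatr_eq0 -lt0n.
by move=> ?; rewrite /gallager; field.
Qed.

Lemma E0_term_continuous N M (rate : R) T : (0 < N)%N ->
  M%:R = expR (N%:R * rate) ->
  {in `[0, 1], continuous
    (fun rho : R => expR (- N%:R * (E0 W Q N rho T - rho * rate)))}.
Proof.
(* If no sequence has type [T], the default [E0 = 0] still leaves an exponential continuous in
   [rho]. *)
move=> N0 hM r r01; rewrite /E0; case: pickP => [s _|_]; last first.
  apply: continuous_cvg; first exact: continuous_expR.
  apply: cvgM; first exact: cvg_cst.
  apply: cvgB; first exact: cvg_cst.
  by apply: cvgM; [exact: cvg_id|exact: cvg_cst].
rewrite /continuous_at (expR_E0_seq _ _ N0 hM).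
under eq_cvg do rewrite (expR_E0_seq _ _ N0 hM).
apply: cvgM.
  apply: cvg_powR; [exact: cvg_cst|exact: cvg_id|].
  by rewrite hM expR_gt0.
by apply: cvg_big => [|n _]; [exact: mul_continuous|exact: gallager_continuous].
Qed.

End Gallager.

Theorem proposition2 (R : realType) (X Y S : finType)
    (W : channel R X Y S) (Q : X -> R) (hQ : is_pmf Q)
    (N M : nat) (hN : (0 < N)%N) (hM : (0 < M)%N)
    (rate : R) (hrate : M%:R = expR (N%:R * rate))
    (mu : 'I_M -> R) (hmu : is_pmf mu)
    (dec : decoder X Y S N M) (hdec : maximum_likelihood W dec)
    (s0 sN : S) :
  let term (T : {ffun S -> R}) (rho : R) : R :=
    expR (- N%:R * (E0 W Q N rho T - rho * rate)) in
  let P (T : {ffun S -> R}) : R := type_prob W Q N mu s0 T sN in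
  let averaged (rho : R) : R := \sum_(T <- types R S N) P T * term T rho in
  [/\ forall T, T \in types R S N -> is_min01 (term T) (min01 (term T)),
      is_min01 averaged (min01 averaged),
      error_prob W Q mu dec s0 sN
        <= \sum_(T <- types R S N) P T * min01 (term T) &
      \sum_(T <- types R S N) P T * min01 (term T) <= min01 averaged].
Proof.
move=> term P averaged.
have term_cont T : {in `[0, 1], continuous (term T)}.
  exact: (E0_term_continuous hQ hN hrate).
have term_min T : is_min01 (term T) (min01 (term T)).
  exact: is_min01_continuous.
have averaged_min : is_min01 averaged (min01 averaged).
  apply: is_min01_continuous => r r01.
  apply: cvg_big => [|T _]; first exact: add_continuous.
  by apply: cvgM; [exact: cvg_cst|exact: term_cont].
have PE T := type_prob_path W hQ N s0 sN T hmu.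
have P0 T : 0 <= P T.
  by rewrite /P PE sumr_ge0// => p _; rewrite mulr_ge0// path_law_ge0.
split => //; last first.
  (* At a minimizer of the average, each term is at least its own minimum. *)
  have [[rho rho01 <-] _] := averaged_min.
  by apply: ler_sum => T _; rewrite ler_wpM2l//; exact: (term_min T).2.
(* Each path has exactly one type, so the average over types becomes an average over paths. *)
have -> : \sum_(T <- types R S N) P T * min01 (term T) =
    \sum_(p : trajectory S N) path_law W s0 p *
      ((final_state p == sN)%:R * min01 (term (type_of R (governing p)))).
  under eq_bigr do rewrite /P PE mulr_suml.
  rewrite exchange_big; apply: eq_bigr => p _ /=.
  rewrite (bigD1_seq (type_of R (governing p))) ?undup_uniq//=; last first.
    by rewrite mem_undup; apply: map_f; rewrite mem_enum.
  rewrite eqxx mulrA big1 ?addr0// => T /negbTE.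
  by rewrite eq_sym => ->; rewrite mulr0 mul0r.
rewrite /error_prob Pr_coding_law; apply: ler_sum => p _.
rewrite ler_wpM2l ?path_law_ge0// /state_path /decoding_fails /=.
case: (final_state p == sN); last first.
  rewrite mul0r big1// => m _; rewrite big1 ?mulr0// => c _.
  by rewrite big1 ?mulr0// => y _; rewrite andbF mulr0.
rewrite mul1r -[leRHS]mul1r -[X in _ <= X * _]hmu.2 mulr_suml; apply: ler_sum => m _.
rewrite ler_wpM2l ?hmu.1//.
(* Here [rho] is the minimizer for the type of the fixed path, so it may vary with the path. *)
have [[rho rho01 <-] _] := term_min (type_of R (governing p)).
rewrite /term E0_type_of (expR_E0_seq W hQ _ _ hN hrate).
apply: le_trans (ml_error_bound hQ p m hdec rho01).
apply: ler_sum => c _; apply: ler_wpM2l.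
  by apply: prodr_ge0 => k _; apply: prodr_ge0 => n _; exact: hQ.1.
by apply: ler_sum => y _; rewrite andbT.
Qed.
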